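(* Let $\mathbb{R}$ be the real line with its usual topology and let $f:\mathbb{R}\to\mathbb{R}$ be the (perfect) mapping $f(x)=2x$. Then the co-compact entropy of $f$ is zero: $c(f)=0$.
   Context: Let $X$ be a non-empty Hausdorff space. A continuous mapping $f:X\to X$ is called perfect if it is a closed mapping and all fibers $f^{-1}(x)$, $x\in X$, are compact. An open set $U\subseteq X$ is co-compact if $X\setminus U$ is a compact subset of $X$. A co-compact open cover of $X$ is an open cover of $X$ all of whose elements are co-compact. Every co-compact open cover has a finite subcover. For a co-compact open cover $\mathcal{U}$ of $X$, $N(\mathcal{U})$ is the smallest cardinality of a subcover of $\mathcal{U}$, and $H(\mathcal{U})=\log N(\mathcal{U})$. For covers $\mathcal{U},\mathcal{V}$, $\mathcal{U}\bigvee\mathcal{V}=\{U\cap V: U\in\mathcal{U}, V\in\mathcal{V}\}$, and $f^{-i}(\mathcal{U})=\{f^{-i}(U):U\in\mathcal{U}\}$ (preimages under the $i$-th iterate). For a perfect mapping $f:X\to X$ and a co-compact open cover $\mathcal{U}$, the co-compact entropy of $f$ relative to $\mathcal{U}$ is $$c(f,\mathcal{U})=\lim_{n\to\infty}\frac1n H\Big(\bigvee_{i=0}^{n-1}f^{-i}(\mathcal{U})\Big)$$ (this limit exists), and the co-compact entropy of $f$ is $c(f)=\sup_{\mathcal{U}}c(f,\mathcal{U})\in[0,\infty]$, the supremum being over all co-compact open covers $\mathcal{U}$ of $X$. *)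

(* Defs.v *)
From HB Require Import structures.
From mathcomp Require Import all_boot all_order all_algebra.
From mathcomp Require Import all_classical all_reals all_analysis.

Set Implicit Arguments.
Unset Strict Implicit.
Unset Printing Implicit Defensive.

Import Order.TTheory GRing.Theory Num.Theory.
Import numFieldNormedType.Exports.

Local Open Scope classical_set_scope.
Local Open Scope card_scope.
Local Open Scope ring_scope.

Section CocompactEntropy.
Variables (R : realType) (T : topologicalType).
Implicit Types (C D : set (set T)) (f : T -> T).

Definition perfect_map f : Prop :=
  [/\ continuous f,
      forall A : set T, closed A -> closed (f @` A)
    & forall x : T, compact (f @^-1` [set x])].

Definition is_cover C : Prop := \bigcup_(U in C) U = setT.

Definition cocompact_open_cover C : Prop :=
  is_cover C /\ forall U, C U -> open U /\ compact (~` U).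

Definition has_subcover_card C (n : nat) : Prop :=
  exists D, [/\ D `<=` C, is_cover D & D #= `I_n].

(* The default value 0 is only used when C has no finite subcover; this does
   not happen for co-compact open covers. *)
Definition cover_number C : nat :=
  xget 0%N [set n | has_subcover_card C n /\
                    forall m, has_subcover_card C m -> (n <= m)%N].

Definition cover_entropy C : R := ln (cover_number C)%:R.

Definition cover_join C D : set (set T) := [set U `&` V | U in C & V in D].

Definition cover_preimage f (i : nat) C : set (set T) :=
  [set iter i f @^-1` U | U in C].

(* [set setT] is neutral for cover_join. *)
Definition iterated_join f C (n : nat) : set (set T) :=
  \big[cover_join/[set setT]]_(i < n) cover_preimage f i C.

(* For f perfect and C a co-compact open cover this sequence converges, by
   subadditivity of its numerators; its value at n = 0 is irrelevant. *)
Definition cocompact_entropy_rel f C : R :=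
  limn (fun n : nat => n%:R^-1 * cover_entropy (iterated_join f C n)).

Definition cocompact_entropy f : \bar R :=
  ereal_sup [set (cocompact_entropy_rel f C)%:E | C in cocompact_open_cover].

End CocompactEntropy.

Arguments cocompact_entropy R {T} f.

(* Main.v *)
Require Import Defs.
From HB Require Import structures.
From mathcomp Require Import all_boot all_order all_algebra finmap.
From mathcomp Require Import all_classical all_reals all_analysis lra.
Import Order.TTheory GRing.Theory Num.Theory.
Import numFieldNormedType.Exports.
Local Open Scope classical_set_scope.
Local Open Scope ring_scope.

(** One member [U0] of a co-compact open cover contains [0], hence a
    neighbourhood of [0], and it also contains all points of large modulus.  An
    orbit of [x |-> 2 * x] crosses the remaining annulus in at most [L] steps,
    with [L] independent of the starting point, so it stays in [U0] outside a
    window of [L] consecutive times.  Inside the window the orbit follows a word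
    of length [L] in a fixed finite subcover of size [k].  Choosing the beginning
    of the window and the word covers the line by [n.+1 * k ^ L] elements of the
    [n]-th iterated join, and this number grows only linearly in [n]. *)

Lemma cover_number_le (T : topologicalType) (C : set (set T)) (I : finType)
    (F : I -> set T) :
  (forall i, C (F i)) -> (forall x, exists i, F i x) ->
  (cover_number C <= #|I|)%N.
Proof.
move=> CF covF; pose D := [fset F i | i : I]%fset.
have cardD : has_subcover_card C #|` D|.
  exists [set` D]; split; last exact/card_eq_fsetP.
    by move=> _ /imfsetP[i _ ->].
  apply/seteqP; split => // x _; have [i Fix] := covF x.
  by exists (F i) => //=; apply/imfsetP; exists i.
have lemI : (#|` D| <= #|I|)%N by rewrite cardE (leq_trans (leq_imfset_card _ _ _)).
(* In the default branch of [xget] the cover number is 0 and the bound is trivial. *)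
rewrite /cover_number; case: xgetP => [n _ [_ nmin]|_ //].
by rewrite (leq_trans (nmin _ cardD)).
Qed.

Lemma mem_iterated_join (T : topologicalType) (f : T -> T) (C : set (set T))
    (n : nat) (W : nat -> set T) :
  (forall i, C (W i)) ->
  iterated_join f C n (\bigcap_(i < n) (iter i f @^-1` W i)).
Proof.
move=> CW; rewrite bigcap_mkord /iterated_join.
(* Membership is carried through the intersection and the join in parallel, starting from [setT] in
   [[set setT]]. *)
pose mem_family (A : set T) (D : set (set T)) := D A.
apply: (@big_ind2 _ _ mem_family) => // [A D B E DA EB|i _].
  by exists A => //; exists B.
by exists (W i).
Qed.

(** Finitely many members cover the compact complement of [U0]; adding [U0] covers the rest. *)
Lemma cocompact_open_cover_finite {T : ptopologicalType} {C : set (set T)}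
    {U0 : set T} :
  cocompact_open_cover C -> C U0 ->
  exists2 D : {fset set T}, {in D, forall U, C U} &
    forall x, exists2 U, U \in D & U x.
Proof.
move=> [covC CU] CU0.
have [_ cU0] := CU _ CU0.
rewrite compact_cover in cU0.
have [U /CU[]//|x _|D sDC covD] := cU0 _ C id.
  by have : [set: T] x by []; rewrite -covC.
exists (U0 |` D)%fset => [U|x].
  by rewrite !inE => /orP[/eqP -> //|/sDC]; rewrite inE.
have [U0x|nU0x] := pselect (U0 x).
  by exists U0; rewrite ?inE ?eqxx.
by have [U DU Ux] := covD _ nU0x; exists U => //; rewrite !inE; apply/orP; right.
Qed.

Lemma cover_number_join_le (T : topologicalType) (f : T -> T)
    (C : set (set T)) (U0 : set T) (J : finType) (V : J -> set T) (L n : nat) :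
  C U0 -> (forall j, C (V j)) -> (forall x, exists j, V j x) ->
  (forall x, exists2 t, (t <= n)%N & forall i, (i < n)%N ->
     ~~ (t <= i < t + L)%N -> U0 (iter i f x)) ->
  (cover_number (iterated_join f C n) <= n.+1 * #|J| ^ L)%N.
Proof.
move=> CU0 CV covV window.
have -> : (n.+1 * #|J| ^ L = #|{: 'I_n.+1 * {ffun 'I_L -> J}}|)%N.
  by rewrite card_prod card_ffun !card_ord.
(* [p] is a window start with a word; [insub] succeeds exactly when [i - p.1 < L], that is, when [i]
   has not passed the end of the window. *)
pose W (p : 'I_n.+1 * {ffun 'I_L -> J}) i :=
  if (p.1 <= i)%N then if insub (i - p.1)%N is Some k then V (p.2 k) else U0
  else U0.
apply: (@cover_number_le _ _ _
  (fun p => \bigcap_(i < n) (iter i f @^-1` W p i))) => [p|x].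
  apply: mem_iterated_join => i; rewrite /W.
  by case: ifP => // _; case: insubP.
have [t ltn U0x] := window x.
have [g Vg] := choice covV.
exists (inord t, [ffun k : 'I_L => g (iter (t + k) f x)]) => i /= ltin.
rewrite /W /= inordK //; case: ifPn => [leti|nleti].
  case: insubP => [k _ kE|]; first by rewrite ffunE kE subnKC //; exact: Vg.
  rewrite -leqNgt => leL; apply: U0x => //.
  by rewrite leti -leqNgt -leq_subRL //.
by apply: U0x => //; rewrite (negbTE nleti).
Qed.

Lemma cvg_ln_linear_growth (R : realType) (a : nat -> nat) (K : nat) :
  (forall n, (a n <= n.+1 * K)%N) ->
  (n%:R^-1 * ln ((a n)%:R : R)) @[n --> \oo] --> (0 : R).
Proof.
move=> aK; apply/cvgr0Pnorm_le => e e0.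
(* Applying [ln y < y] to [y = n.+1 * d] bounds [ln n.+1] by [n.+1 * d - ln d]. Since
   [n.+1 * d <= 2 * n * d = n * e / 2], the other half of [n * e] is left to absorb the constant
   [c]. *)
pose d : R := e / 4.
have d0 : 0 < d by rewrite /d; lra.
pose c : R := `|ln K.+1%:R - ln d|.
near=> n.
have n1 : 1 <= n%:R :> R by rewrite ler1n; near: n; exact: nbhs_infty_gt.
have n0 : 0 < n%:R :> R by lra.
have nc : c * 2 / e <= n%:R by near: n; exact: nbhs_infty_ger.
have ln_a0 : 0 <= ln ((a n)%:R : R).
  by case: (a n) => [|m]; [rewrite ln0|rewrite ln_ge0 // ler1n].
rewrite ger0_norm; last by rewrite mulr_ge0 // invr_ge0 ltW.
rewrite mulrC ler_pdivrMr //.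
have nS0 : 0 < n.+1%:R :> R by rewrite ltr0n.
have K0 : 0 < K.+1%:R :> R by rewrite ltr0n.
(* [K.+1] replaces [K] so that the logarithm of the product splits even when [K = 0]. *)
have le_ln : ln ((a n)%:R : R) <= ln (n.+1%:R * K.+1%:R).
  case: (posnP (a n)) => [->|an0].
    rewrite ln0 // ln_ge0 // -natrM ler1n //.
  rewrite ler_ln ?posrE ?mulr_gt0 ?ltr0n // -natrM ler_nat.
  by rewrite (leq_trans (aK n)) // leq_mul2l leqnSn orbT.
have lnd : ln (n.+1%:R * d) < n.+1%:R * d by rewrite ln_sublinear // mulr_gt0.
rewrite lnM ?posrE // in le_ln; rewrite (lnM nS0 d0) in lnd.
have c1 : ln K.+1%:R - ln d <= c by exact: ler_norm.
have nd : n.+1%:R * d <= 2 * n%:R * d by rewrite ler_pM2r // -natr1; lra.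
have : c * 2 <= n%:R * e by rewrite -ler_pdivrMr.
have -> : e = d * 4 by rewrite /d; lra.
lra.
Unshelve. all: by end_near.
Qed.

Lemma cocompact_entropy_rel_eq0 {R : realType} {T : ptopologicalType}
    {f : T -> T} {C : set (set T)} {U0 : set T} {L : nat} :
  cocompact_open_cover C -> C U0 ->
  (forall n x, exists2 t, (t <= n)%N & forall i, (i < n)%N ->
     ~~ (t <= i < t + L)%N -> U0 (iter i f x)) ->
  cocompact_entropy_rel R f C = 0.
Proof.
move=> covC CU0 window.
have [D DC covD] := cocompact_open_cover_finite covC CU0.
apply/cvg_lim => //.
apply: (@cvg_ln_linear_growth _ (fun n => cover_number (iterated_join f C n))
  (#|{: D}| ^ L)) => n.
apply: (@cover_number_join_le _ _ _ U0 _ (fun U : D => val U)) => //.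
  by move=> U; apply: DC; exact: fsvalP.
by move=> x; have [U UD Ux] := covD x; exists [` UD]%fset.
Qed.

Lemma iter_double (R : pzRingType) (i : nat) (x : R) :
  iter i ( *%R 2) x = 2 ^+ i * x.
Proof. by elim: i => [|i IH] /=; rewrite ?expr0 ?mul1r // IH exprS mulrA. Qed.

Lemma double_orbit_window {R : realType} {U : set R} : open U -> compact (~` U) -> U 0 ->
  exists L : nat, forall n x, exists2 t, (t <= n)%N & forall i, (i < n)%N ->
     ~~ (t <= i < t + L)%N -> U (iter i ( *%R 2) x).
Proof.
move=> oU cU U0.
have [e /= e0 eU] : exists2 e : R, 0 < e & forall y, `|y| < e -> U y.
  have /nbhs_ballP[e /= e0 eU] := open_nbhs_nbhs (conj oU U0).
  by exists e => // y ye; apply: eU; rewrite /ball /= sub0r normrN.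
have [M MU] : exists M : R, forall y, M < `|y| -> U y.
  have /compact_bounded[M [_ bM]] := cU; exists M => y My.
  have [//|nUy] := pselect (U y).
  (* Only numbers strictly above [M] are known to bound the complement, hence the midpoint of [M]
     and [|y|]. *)
  have [Mr ry] := midf_lt My.
  by have := bM _ Mr y nUy; rewrite /= leNgt ry.
(* This many doublings take any modulus at least [e] beyond [M]. *)
exists (Num.bound (M / e)) => n x.
have ML : M < 2 ^+ Num.bound (M / e) * e.
  by rewrite -ltr_pdivrMr //; exact: upper_nthrootP.
(* The window opens at the first time of modulus at least [e]. The alternative [i == n] makes that
   time exist, even for [x = 0], and caps it at [n]. *)
pose far := [pred i : nat | (i == n) || (e <= `|2 ^+ i * x|)].
have exfar : exists i, far i by exists n; rewrite /= eqxx.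
have [t tfar tmin] := ex_minnP exfar.
exists t; first by apply: tmin; rewrite /= eqxx.
move=> i ltin; rewrite negb_and -!ltnNge iter_double => /orP[ltit|].
  apply: eU; rewrite ltNge; apply/negP => ei.
  by have := tmin i; rewrite /= ei orbT => /(_ isT); rewrite leqNgt ltit.
rewrite ltnS => leti; apply: MU.
(* A time past the window forces [t < n], so [t] was selected by its modulus. *)
have ltn_tn : (t < n)%N by rewrite (leq_ltn_trans _ ltin) // (leq_trans _ leti) ?leq_addr.
have et : e <= `|2 ^+ t * x|.
  by move: tfar => /= /orP[/eqP tn|//]; rewrite tn ltnn in ltn_tn.
apply: (lt_le_trans ML); rewrite -(subnKC (leq_trans (leq_addr _ _) leti)).
rewrite addnC exprD -mulrA normrM ger0_norm ?exprn_ge0 //.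
rewrite ler_pM ?exprn_ge0 ?(ltW e0) //.
by rewrite ler_weXn2l ?ler1n // leq_subRL // (leq_trans (leq_addr _ _) leti).
Qed.

(** Halving is a continuous inverse, so images are preimages under halving and fibers are
    singletons. *)
Lemma double_perfect (R : realType) : perfect_map ( *%R (2 : R)).
Proof.
have fP (y z : R) : (2 * y = z) <-> (y = 2^-1 * z).
  by split=> [<-|->]; rewrite mulrA ?mulVf ?mulfV ?mul1r.
split=> [|A cA|x]; first exact: mulrl_continuous.
- have -> : ( *%R 2) @` A = ( *%R 2^-1) @^-1` A.
    apply/seteqP; split=> [_ [y Ay <-]|z Az] /=; first by rewrite -((fP _ _).1 erefl).
    by exists (2^-1 * z) => //; apply/fP.
  by apply: preimage_closed => // y _; exact: mulrl_continuous.
- have -> : ( *%R 2) @^-1` [set x] = [set 2^-1 * x].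
    by apply/seteqP; split=> y /= /fP.
  exact: compact_set1.
Qed.

Lemma double_entropy_rel (R : realType) (C : set (set R)) :
  cocompact_open_cover C -> cocompact_entropy_rel R (fun x : R => 2 * x) C = 0.
Proof.
move=> covC; have [U CU U0] : (\bigcup_(U in C) U) (0 : R) by rewrite covC.1.
have [oU cU] := covC.2 _ CU.
have [L window] := double_orbit_window oU cU U0.
exact: cocompact_entropy_rel_eq0 window.
Qed.

Theorem mainTheorem5 (R : realType) :
  perfect_map (fun x : R => 2 * x) /\
  cocompact_entropy R (fun x : R => 2 * x) = 0%E.
Proof.
split; first exact: double_perfect.
rewrite -[RHS](ereal_sup1 (0%E : \bar R)) /cocompact_entropy; congr ereal_sup.
apply/seteqP; split=> [_ [C covC <-]|_ ->]; first by rewrite double_entropy_rel.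
(* A cover must be exhibited, since the supremum of an empty set would be [-oo]. *)
have covT : cocompact_open_cover [set [set: R]].
  split; first exact: bigcup_set1.
  by move=> _ ->; rewrite setCT; split; [exact: openT|exact: compact0].
by exists [set setT]; rewrite ?double_entropy_rel.
Qed.
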